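(* Let $p$ be a prime. If $G$ is a finite noncyclic $p$-group such that $G$ is not powerful, and $K$ is a powerful finite $p$-group, then $\sigma_P(G \times K) = \sigma_P(G)$.
   Context: For a group $G$ and a positive integer $k$, $G^k$ denotes the subgroup generated by $\{g^k \mid g\in G\}$, and $[G,G]$ is the commutator subgroup. A finite $p$-group $G$ ($p$ prime) is called powerful if either $p$ is odd and $[G,G]\subseteq G^p$, or $p=2$ and $[G,G]\subseteq G^4$. A cover of a group $G$ is a collection of proper subgroups of $G$ whose union is $G$. A powerful cover of a finite $p$-group $G$ is a cover of $G$ all of whose members are powerful groups. The powerful covering number $\sigma_P(G)$ of a finite noncyclic $p$-group $G$ is the smallest number of subgroups in a powerful cover of $G$. *)

(* Defs.v *)
From mathcomp Require Import all_boot all_fingroup all_solvable.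

Set Implicit Arguments.
Unset Strict Implicit.
Unset Printing Implicit Defensive.

Import GroupScope.

Section PowerfulCovers.

Variable gT : finGroupType.
Implicit Types (A : {set gT}) (G H : {group gT}) (C : {set {group gT}}).

Definition power_subgroup k A : {set gT} := <<[set x ^+ k | x in A]>>.

Definition powerful (p : nat) A :=
  p.-group A &&
  ((odd p && ([~: A, A] \subset power_subgroup p A))
   || ((p == 2) && ([~: A, A] \subset power_subgroup 4 A))).

Definition is_cover A C :=
  [forall H in C, (H : {set gT}) \proper A] && (\bigcup_(H in C) H == A).

Definition is_powerful_cover (p : nat) A C :=
  is_cover A C && [forall H in C, powerful p H].

(* The default value of the minimization, the family of cyclic subgroups, is  *)
(* itself a powerful cover when A is a noncyclic p-group (see sigmaP_spec);   *)
(* for other A the value may be meaningless.                                  *)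
Definition sigmaP (p : nat) A : nat :=
  #|[arg min_(C < [set <[x]>%G | x in A] | is_powerful_cover p A C) #|C| ]|.

Lemma abelian_powerful (p : nat) G : prime p -> p.-group G -> abelian G -> powerful p G.
Proof.
move=> p_pr pG /commG1P cG1; rewrite /powerful pG cG1 !sub1G !andbT /=.
by rewrite orbC; case: (even_prime p_pr) => ->; rewrite ?orbT.
Qed.

Lemma cycles_powerful_cover (p : nat) G :
    prime p -> p.-group G -> ~~ cyclic G ->
  is_powerful_cover p G [set <[x]>%G | x in G].
Proof.
move=> p_pr pG ncG; apply/andP; split; last first.
  apply/forall_inP=> _ /imsetP[x Gx ->]; apply: abelian_powerful => //.
    by apply: pgroupS pG; rewrite cycle_subG.
  exact: cycle_abelian.
apply/andP; split.
  apply/forall_inP=> _ /imsetP[x Gx ->]; rewrite properEneq cycle_subG Gx andbT.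
  by apply: contra ncG => /eqP <-; apply: cycle_cyclic.
rewrite eqEsubset; apply/andP; split.
  by apply/bigcupsP=> _ /imsetP[x Gx ->]; rewrite cycle_subG.
apply/subsetP=> x Gx; apply/bigcupP; exists <[x]>%G; last exact: cycle_id.
exact: imset_f.
Qed.

Lemma sigmaP_spec (p : nat) G :
    prime p -> p.-group G -> ~~ cyclic G ->
  (exists2 C, is_powerful_cover p G C & #|C| = sigmaP p G)
  /\ (forall C, is_powerful_cover p G C -> sigmaP p G <= #|C|).
Proof.
move=> p_pr pG ncG; rewrite /sigmaP.
by case: arg_minnP => [|C cC minC]; [exact: cycles_powerful_cover | split=> //; exists C].
Qed.

End PowerfulCovers.

(* Main.v *)
Require Import Defs.
From mathcomp Require Import all_boot all_fingroup all_solvable.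

Set Implicit Arguments.
Unset Strict Implicit.
Unset Printing Implicit Defensive.

Import GroupScope.

(** Powerful covers pass in both directions between G and G x K.  Given a
    powerful cover of G, multiplying each member by K gives a cover of G x K by
    proper subgroups, and these are powerful because powerfulness is stable
    under direct products ([powerful_dprod], [powerful_setX]).  Conversely, the
    first projection sends a powerful cover of G x K to a family of subgroups of
    G with union G; its members are powerful because powerfulness is stable
    under homomorphic images ([morphim_powerful]), and they are proper because
    G itself is not powerful.  Neither passage increases the number of members,
    so the two minima agree; both are attained since G, and hence G x K, is not
    cyclic. *)

(** One exponent for both parities, so that the stability properties below need
    no case distinction on the prime. *)
Definition powerful_exponent p := if p == 2 then 4 else p.

Lemma powerfulE (p : nat) (gT : finGroupType) (A : {set gT}) :
  prime p ->
  powerful p A =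
    p.-group A && ([~: A, A] \subset power_subgroup (powerful_exponent p) A).
Proof.
move=> p_pr; rewrite /powerful /powerful_exponent.
case: (even_prime p_pr) => [-> // | p_odd]; rewrite p_odd.
by case: eqP p_odd => [-> | _ _] //; rewrite orbF.
Qed.

Lemma power_subgroupS k (gT : finGroupType) (A B : {set gT}) :
  A \subset B -> power_subgroup k A \subset power_subgroup k B.
Proof. by move=> sAB; apply/genS/imsetS. Qed.

Lemma morphim_power_subgroup k (aT rT : finGroupType) (D A : {group aT})
    (f : {morphism D >-> rT}) :
  A \subset D -> f @* power_subgroup k A \subset power_subgroup k (f @* A).
Proof.
move=> sAD; have sXD : [set x ^+ k | x in A] \subset D.
  by apply/subsetP=> _ /imsetP[x Ax ->]; rewrite groupX ?(subsetP sAD).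
rewrite morphim_gen //; apply/genS/subsetP=> _ /morphimP[_ _ /imsetP[x Ax ->] ->].
have Dx := subsetP sAD x Ax; rewrite morphX //.
by apply/imset_f/mem_morphim.
Qed.

Lemma morphim_powerful (p : nat) (aT rT : finGroupType) (D A : {group aT})
    (f : {morphism D >-> rT}) :
  prime p -> A \subset D -> powerful p A -> powerful p (f @* A).
Proof.
move=> p_pr sAD; rewrite !powerfulE // => /andP[pA sAA].
rewrite morphim_pgroup //= -morphimR //.
exact: subset_trans (morphimS f sAA) (morphim_power_subgroup _ _ sAD).
Qed.

(** The derived subgroup of H x K is H' x K', and each factor already lies in
    the subgroup generated by the powers of that factor. *)
Lemma powerful_dprod (p : nat) (gT : finGroupType) (H K G : {group gT}) :
  prime p -> H \x K = G -> powerful p H -> powerful p K -> powerful p G.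
Proof.
move=> p_pr defG; rewrite !powerfulE // => /andP[pH sHH] /andP[pK sKK].
have /dprodP[_ defHK _ _] := defG.
rewrite -{1}defHK pgroupM pH pK /=.
have [_ defG1 _ _] := dprodP (der_dprod 1 defG); rewrite -derg1 -defG1 mul_subG //.
  apply: subset_trans sHH _; apply: power_subgroupS.
  by rewrite -defHK mulG_subl.
apply: subset_trans sKK _; apply: power_subgroupS.
by rewrite -defHK mulG_subr.
Qed.

Lemma powerful_setX (p : nat) (gT rT : finGroupType) (H : {group gT})
    (K : {group rT}) :
  prime p -> powerful p H -> powerful p K -> powerful p (setX H K).
Proof.
move=> p_pr powH powK; apply: (powerful_dprod p_pr (setX_dprod H K)) => /=.
  by rewrite -morphim_pairg1; apply: morphim_powerful; rewrite ?subsetT.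
by rewrite -morphim_pair1g; apply: morphim_powerful; rewrite ?subsetT.
Qed.

Lemma is_powerful_coverP (p : nat) (gT : finGroupType) (A : {set gT})
    (C : {set {group gT}}) :
  reflect [/\ forall H : {group gT}, H \in C -> H \proper A,
              \bigcup_(H in C) H = A
            & forall H : {group gT}, H \in C -> powerful p H]
          (is_powerful_cover p A C).
Proof.
apply: (iffP andP) => [[/andP[/forall_inP prC /eqP covC] /forall_inP powC] // |].
case=> prC covC powC; rewrite /is_cover covC eqxx andbT.
by split; apply/forall_inP.
Qed.

Lemma powerful_cover_setX (p : nat) (gT rT : finGroupType) (G : {group gT})
    (K : {group rT}) (C : {set {group gT}}) :
  prime p -> powerful p K -> is_powerful_cover p G C ->
  is_powerful_cover p (setX G K) [set setX_group H K | H : {group gT} in C].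
Proof.
move=> p_pr powK /is_powerful_coverP[prC covC powC].
apply/is_powerful_coverP; split=> [_ /imsetP[H CH ->] | | _ /imsetP[H CH ->]].
- have /properP[sHG [x Gx notHx]] := prC H CH.
  apply/properP; split; first exact: setXS.
  by exists (x, 1); rewrite inE /= ?Gx ?(negPf notHx) ?group1.
- apply/setP=> -[x y]; rewrite inE -covC /=; apply/bigcupP/andP.
    case=> _ /imsetP[H CH ->]; rewrite inE /= => /andP[Hx Ky].
    by split=> //; apply/bigcupP; exists H.
  case=> /bigcupP[H CH Hx] Ky; exists (setX_group H K); first exact: imset_f.
  by rewrite inE /= Hx.
by apply: powerful_setX; rewrite ?powC.
Qed.

(** Proper subgroups of G x K, such as G x 1 for nontrivial K, can project onto
    all of G; a powerful one cannot, since its image is powerful and G is not. *)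
Lemma powerful_cover_fst (p : nat) (gT rT : finGroupType) (G : {group gT})
    (K : {group rT}) (C : {set {group gT * rT}}) :
  prime p -> ~~ powerful p G -> is_powerful_cover p (setX G K) C ->
  is_powerful_cover p G
    [set (@fst gT rT @* L)%G | L : {group gT * rT} in C].
Proof.
move=> p_pr npowG /is_powerful_coverP[prC covC powC].
have powfC (L : {group gT * rT}) : L \in C -> powerful p (@fst gT rT @* L).
  by move=> CL; apply: morphim_powerful; rewrite ?subsetT ?powC.
apply/is_powerful_coverP; split=> [_ /imsetP[L CL ->] | | _ /imsetP[L CL ->]].
- rewrite properEneq; apply/andP; split.
    by apply: contraNneq npowG => <-; apply: powfC.
  by rewrite -[G : {set _}](morphim_fstX G K) morphimS ?proper_sub ?prC.
- rewrite -[RHS](morphim_fstX G K) -covC.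
  apply/setP=> x; apply/bigcupP/morphimP.
    case=> _ /imsetP[L CL ->] /morphimP[z _ Lz ->].
    by exists z; rewrite ?inE //; apply/bigcupP; exists L.
  case=> z _ /bigcupP[L CL Lz] ->; exists (@fst gT rT @* L)%G.
    exact: imset_f.
  by apply: mem_morphim; rewrite ?inE.
exact: powfC.
Qed.

Theorem theorem3p4 (p : nat) (gT rT : finGroupType)
    (G : {group gT}) (K : {group rT}) :
  prime p -> p.-group G -> ~~ cyclic G -> ~~ powerful p G ->
  powerful p K ->
  sigmaP p (setX G K) = sigmaP p G.
Proof.
move=> p_pr pG ncG npowG powK; have /andP[pK _] := powK.
have pGK : p.-group (setX G K) by rewrite /pgroup cardsX pnatM; apply/andP.
have ncGK : ~~ cyclic (setX G K).
  apply: contra ncG => cycGK; rewrite -[G : {set _}](morphim_fstX G K).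
  exact: morphim_cyclic.
have [[C covC cardC] minG] := sigmaP_spec p_pr pG ncG.
have [[D covD cardD] minGK] :=
  sigmaP_spec (G := setX_group G K) p_pr pGK ncGK.
apply/eqP; rewrite eqn_leq; apply/andP; split.
  rewrite -cardC; apply: leq_trans (leq_imset_card _ _).
  exact/minGK/powerful_cover_setX.
rewrite -cardD; apply: leq_trans (leq_imset_card _ _).
exact/minG/(powerful_cover_fst (K := K)).
Qed.
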